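(* Let $A\in\mathbb{R}^{m\times n}$, $b\in\mathbb{R}^m$ with $Ax=b$ consistent and $x^*$ satisfying $Ax^*=b$, let $B\in\mathbb{R}^{n\times n}$ be symmetric positive definite, and let $S$ be a random matrix with $m$ rows. Starting from $x^0\in\mathbb{R}^n$, let $\{x^k\}$ be the random iterates $$x^{k+1}=x^k-B^{-1}A^\top S(S^\top AB^{-1}A^\top S)^\dagger S^\top(Ax^k-b),$$ where in each iteration $S$ is a fresh independent copy of the random matrix. If $\mathbf{E}[Z]$ is positive definite, then for all $k\ge0$ $$\mathbf{E}\left[\|x^k-x^*\|_B^2\right]\le\rho^k\|x^0-x^*\|_B^2,$$ where $\rho=1-\lambda_{\min}(B^{-1/2}\mathbf{E}[Z]B^{-1/2})<1$.
   Context: $Z=A^\top S(S^\top AB^{-1}A^\top S)^\dagger S^\top A$, where $\dagger$ denotes the Moore–Penrose pseudoinverse; $\lambda_{\min}$ is the smallest eigenvalue; $\|x\|_B=\sqrt{x^\top Bx}$; $B^{-1/2}$ is the symmetric positive definite square root of $B^{-1}$. The number of columns of the random matrix $S$ is arbitrary (it may itself be random). The starting point $x^0$ is deterministic. *)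

(* Defs.v *)
From HB Require Import structures.
From mathcomp Require Import all_boot all_order all_algebra.
From mathcomp Require Import all_classical all_reals all_analysis.

Set Implicit Arguments.
Unset Strict Implicit.
Unset Printing Implicit Defensive.

Import Order.TTheory GRing.Theory Num.Theory.
Import numFieldNormedType.Exports.

Local Open Scope classical_set_scope.
Local Open Scope ring_scope.

Definition posdef (R : realType) (n : nat) (M : 'M[R]_n) : Prop :=
  forall v : 'cV[R]_n, v != 0 -> 0 < (v^T *m M *m v) 0 0.

Definition normB (R : realType) (n : nat) (B : 'M[R]_n) (x : 'cV[R]_n) : R :=
  Num.sqrt ((x^T *m B *m x) 0 0).

(* The four Penrose equations; they have exactly one solution [X], so the
   default value of [xget] in [mpinv] is never used. *)
Definition is_mpinv (R : realType) (p q : nat)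
    (M : 'M[R]_(p, q)) (X : 'M[R]_(q, p)) : Prop :=
  [/\ M *m X *m M = M, X *m M *m X = X,
      (M *m X)^T = M *m X & (X *m M)^T = X *m M].

Definition mpinv (R : realType) (p q : nat) (M : 'M[R]_(p, q)) : 'M[R]_(q, p) :=
  xget 0 [set X | is_mpinv M X].

(* The symmetric positive definite square root, which exists and is unique
   when [M] is symmetric positive definite; junk value 0 otherwise. *)
Definition spd_sqrt (R : realType) (n : nat) (M : 'M[R]_n) : 'M[R]_n :=
  xget 0 [set X | [/\ X^T = X, posdef X & X *m X = M]].

(* Smallest eigenvalue, which exists when [M] is symmetric of positive size;
   junk value 0 when [M] has no smallest (real) eigenvalue. *)
Definition lambda_min (R : realType) (n : nat) (M : 'M[R]_n) : R :=
  xget 0 [set a | eigenvalue M a /\ forall c, eigenvalue M c -> a <= c].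

(* Real matrices with [m] rows and an arbitrary number of columns: the first
   component [tag s] is the number of columns, [tagged s] is the matrix. *)
Definition sketch (R : realType) (m : nat) : Type :=
  {q : nat & 'M[R]_(m, q)}.

HB.instance Definition _ (R : realType) (m : nat) :=
  Choice.copy (sketch R m) {q : nat & 'M[R]_(m, q)}.
HB.instance Definition _ (R : realType) (m : nat) :=
  isPointed.Build (sketch R m) (Tagged (fun q => 'M[R]_(m, q)) (0 : 'M[R]_(m, 0))).

(* Generators of the disjoint-union sigma-algebra on [sketch R m], where each
   ['M[R]_(m, q)] carries its Borel sigma-algebra (generated by the entries). *)
Definition sketch_gen (R : realType) (m : nat) : set (set (sketch R m)) :=
  [set U | exists q : nat, U = [set s | tag s = q]] `|`
  [set U | exists (q : nat) (i : 'I_m) (j : 'I_q) (Y : set R), measurable Y /\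
     U = Tagged (fun q => 'M[R]_(m, q)) @` [set M : 'M[R]_(m, q) | Y (M i j)]].

HB.instance Definition _ (R : realType) (m : nat) :=
  @isMeasurable.Build (sigma_display (@sketch_gen R m)) (sketch R m)
    <<s @sketch_gen R m >> (@sigma_algebra0 _ setT (@sketch_gen R m))
    (@sigma_algebraC _ (@sketch_gen R m))
    (@sigma_algebra_bigcup _ setT (@sketch_gen R m)).

Definition sketchZ (R : realType) (m n : nat)
    (A : 'M[R]_(m, n)) (B : 'M[R]_n) (s : sketch R m) : 'M[R]_n :=
  let S := tagged s in
  A^T *m S *m mpinv (S^T *m A *m invmx B *m A^T *m S) *m S^T *m A.

Definition expectation_mx (d : measure_display) (T : measurableType d)
    (R : realType) (P : probability T R) (p q : nat)
    (X : T -> 'M[R]_(p, q)) : 'M[R]_(p, q) :=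
  \matrix_(i, j) fine ('E_P[fun w => X w i j])%E.

Fixpoint iterates (R : realType) (m n : nat)
    (A : 'M[R]_(m, n)) (b : 'cV[R]_m) (B : 'M[R]_n) (x0 : 'cV[R]_n)
    (s : nat -> sketch R m) (k : nat) : 'cV[R]_n :=
  if k is k'.+1 then
    let x := iterates A b B x0 s k' in
    let S := tagged (s k') in
    x - invmx B *m A^T *m S *m mpinv (S^T *m A *m invmx B *m A^T *m S)
          *m S^T *m (A *m x - b)
  else x0.

Definition same_distribution (d d' : measure_display)
    (T : measurableType d) (E : measurableType d') (R : realType)
    (P : probability T R) (X Y : {RV P >-> E}) : Prop :=
  forall U : set E, measurable U -> distribution P X U = distribution P Y U.

(* Mutual independence: product rule over every finite set of indices. *)
Definition independent_seq (d d' : measure_display)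
    (T : measurableType d) (E : measurableType d') (R : realType)
    (P : probability T R) (X : nat -> {RV P >-> E}) : Prop :=
  forall (J : seq nat) (U : nat -> set E),
    uniq J -> (forall i, measurable (U i)) ->
    P (\bigcap_(i in [set` J]) X i @^-1` U i) =
    (\prod_(i <- J) P (X i @^-1` U i))%E.

(* Main.v *)
(* With [W = B^-1], the matrix [Z] satisfies [Z W Z = Z] and [0 <= Z <= B], so
   the error [r_k = x_k - xs] obeys [r_{k+1} = (1 - W Z_k) r_k] and
   [|r_{k+1}|_B^2 = |r_k|_B^2 - r_k^T Z_k r_k].  As [Z_k] is independent of
   [r_k], the last term has expectation [E[r_k^T E[Z] r_k]], which is at least
   [lambda_min * E|r_k|_B^2].  All these random variables are bounded since
   [Z <= B]; [Z] is measurable as the pointwise limit of the rational functions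
   [K (K + eps B)^-1 B] of [K = A^T S S^T A]; and independence is transferred
   from events to bounded functions by uniform approximation. *)

Require Import Defs.
From mathcomp Require Import all_boot all_order all_algebra.
From mathcomp Require Import all_classical all_reals all_analysis.
From mathcomp Require Import spectral complex.
From mathcomp Require Import measurable_realfun measurable_fun_approximation.
From mathcomp Require Import ring lra.

Set Implicit Arguments.
Unset Strict Implicit.
Unset Printing Implicit Defensive.

Import Order.TTheory GRing.Theory Num.Theory.
Import numFieldNormedType.Exports.

Local Open Scope classical_set_scope.
Local Open Scope ring_scope.

(** The pseudoinverse, the square root and the smallest eigenvalue are chosen by [xget], so each
    needs an existence proof; all three come from the real spectral theorem, obtained by deflation
    from a single real eigenvalue. The pseudoinverse jumps where the rank drops, and the width of
    [S] varies. Measurability therefore passes through [S *m S^T], which has a fixed size and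
    determines Z. Independence is given for events on the sketches, whereas the step needs it for
    the error. Instead of a sigma-algebra of the past, the induction on k carries a factorization
    rule: the expectation of a product of two error coordinates splits off from every finite family
    of events on the sketches of index at least k. Quadratic forms of the error are linear
    combinations of such products. *)

(** * Spectral theorem for real symmetric matrices *)

Lemma complex_real (R : rcfType) (z : R[i]) :
  z \is Num.real -> exists r : R, z = real_complex R r.
Proof.
case: z => a b; rewrite realE !lecE /= !(eq_sym b) !(eq_sym 0).
move=> H; exists a; congr Complex.
by case/orP: H => /andP[/eqP].
Qed.

(** Over [R[i]] the matrix is Hermitian, hence unitarily diagonalizable with real diagonal; being an
    eigenvalue is invariant under the embedding of [R], so the first diagonal entry descends. *)
Lemma symmetric_eigenvalue (R : rcfType) (n : nat) (N : 'M[R]_n.+1) :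
  N^T = N -> exists a, eigenvalue N a.
Proof.
move=> Nsym; pose C := R[i]%C; pose NC := map_mx (real_complex R) N.
have hN : NC \is hermsymmx.
  apply: realsym_hermsym.
    apply/is_hermitianmxP; rewrite expr0 scale1r map_mx_id //.
    by apply/matrixP => i j; rewrite !mxE -{1}Nsym mxE.
  by apply/mxOverP => i j; rewrite mxE realE !lecE /= eqxx /= le_total.
have /mxOverP/(_ 0 0)/complex_real[r rE] := hermitian_spectral_diag_real hN.
exists r; rewrite -(eigenvalue_map (real_complex R)).
suff : eigenvalue NC (spectral_diag NC 0 0) by rewrite rE.
clear r rE.
have /orthomx_spectralP := hermitian_normalmx hN.
set U := spectralmx _; set D := spectral_diag _ => NE.
have Uu : U \in unitmx by apply: spectral_unit.
apply/eigenvalueP; exists (row 0 U).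
  rewrite -/NC NE !mulmxA -row_mul mulmxV // row1 -rowE row_diag_mx.
  by rewrite -scalemxAl -rowE.
apply/eqP => U0; have : row 0 U *m invmx U = 0 by rewrite U0 mul0mx.
rewrite -row_mul mulmxV // row1 => /matrixP/(_ 0 0) /eqP.
by rewrite !mxE !eqxx oner_eq0.
Qed.

Lemma trmxZ (R : pzRingType) (m n : nat) (a : R) (M : 'M[R]_(m, n)) :
  (a *: M)^T = a *: M^T.
Proof. exact: linearZ. Qed.

Lemma trmx_mul_ge0 (R : realDomainType) (n : nat) (v : 'cV[R]_n) :
  0 <= (v^T *m v) 0 0.
Proof. by rewrite mxE sumr_ge0 // => i _; rewrite mxE -expr2 sqr_ge0. Qed.

Lemma trmx_mul_eq0 (R : realDomainType) (n : nat) (v : 'cV[R]_n) :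
  ((v^T *m v) 0 0 == 0) = (v == 0).
Proof.
apply/idP/eqP => [|->]; last by rewrite mulmx0 mxE.
rewrite mxE psumr_eq0 => [/allP v0|i _]; last by rewrite mxE -expr2 sqr_ge0.
apply/matrixP => i j; rewrite (ord1 j) [RHS]mxE; apply/eqP.
by have := v0 i (mem_index_enum i); rewrite mxE -expr2 sqrf_eq0.
Qed.

(* Householder reflection. *)
Lemma orthogonal_to_basis (R : realFieldType) (n : nat) (v : 'cV[R]_n.+1) :
  (v^T *m v) 0 0 = 1 ->
  exists H : 'M[R]_n.+1, [/\ H^T = H, H *m H = 1%:M & H *m delta_mx 0 0 = v].
Proof.
move=> v1; pose e : 'cV[R]_n.+1 := delta_mx 0 0.
have [->|v_e] := eqVneq v e.
  by exists 1%:M; rewrite trmx1 !mul1mx.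
pose w := v - e; pose s := (w^T *m w) 0 0.
have s0 : s != 0 by rewrite trmx_mul_eq0 subr_eq0.
have ve : w^T *m e = (- (s / 2))%:M.
  rewrite [LHS]mx11_scalar; congr (_%:M); rewrite /s /w linearB /=.
  have ee : (e^T *m e) 0 0 = 1.
    by rewrite /e trmx_delta mul_delta_mx mxE !eqxx.
  have ev : (e^T *m v) 0 0 = (v^T *m e) 0 0.
    by rewrite -[in RHS](trmxK e) -trmx_mul [RHS]mxE.
  rewrite !mulmxBl !mulmxBr; rewrite !mxE in v1 ee ev *.
  by rewrite v1 ee ev; field.
have ww : w^T *m w = s%:M by rewrite [LHS]mx11_scalar.
exists (1%:M - (2 / s) *: (w *m w^T)); split.
- by rewrite linearB /= trmx1 trmxZ trmx_mul trmxK.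
- rewrite mulmxBl mul1mx mulmxBr mulmx1 -scalemxAl -scalemxAr.
  rewrite mulmxA -(mulmxA w) ww mul_mx_scalar -scalemxAl !scalerA.
  have -> : 2 / s * (2 / s * s) = 2 / s + 2 / s by field.
  by rewrite scalerDl opprB addrK subrK.
- rewrite mulmxBl mul1mx -scalemxAl -mulmxA ve mul_mx_scalar scalerA.
  by rewrite (_ : _ * _ = -1) ?scaleN1r ?opprK ?subrKC //; field.
Qed.

(** Deflation: a reflection [H] sends the first basis vector to a unit eigenvector, so [H *m N *m H]
    has first column [a] times that basis vector. By symmetry it is block diagonal, and the
    induction applies to the lower block. The eigenvectors are the rows of [U]. *)
Lemma symmetric_spectral (R : rcfType) (n : nat) (N : 'M[R]_n) :
  N^T = N -> exists (U : 'M[R]_n) (d : 'rV[R]_n),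
    U *m U^T = 1%:M /\ N = U^T *m diag_mx d *m U.
Proof.
elim: n N => [|n IH] N Nsym.
  by exists 0, 0; split; apply/matrixP => -[].
have [a /eigenvalueP[u uN u0]] := symmetric_eigenvalue Nsym.
pose t := Num.sqrt ((u *m u^T) 0 0).
have ut : 0 < (u *m u^T) 0 0.
  have := trmx_mul_ge0 u^T; have := trmx_mul_eq0 u^T.
  by rewrite trmxK le_eqVlt eq_sym => -> /orP[|//]; rewrite trmx_eq0 (negPf u0).
have t0 : t != 0 by rewrite sqrtr_eq0 -ltNge.
pose v := t^-1 *: u^T.
have v1 : (v^T *m v) 0 0 = 1.
  rewrite /v trmxZ trmxK -scalemxAl -scalemxAr scalerA mxE.
  by rewrite -[X in _ * X](sqr_sqrtr (ltW ut)) -/t; field.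
have Nv : N *m v = a *: v.
  rewrite /v -scalemxAr -[N in LHS]Nsym -trmx_mul uN trmxZ.
  by rewrite !scalerA mulrC.
have [H [Hsym HH He]] := orthogonal_to_basis v1.
have [M ME] : exists M : 'M[R]_(1 + n), M = H *m N *m H by eexists.
have Msym : M^T = M by rewrite ME !trmx_mul Hsym Nsym mulmxA.
have Me (i : 'I_n.+1) : M i 0 = a * (i == 0)%:R.
  transitivity ((H *m N *m H *m delta_mx 0 0 : 'cV_n.+1) i 0).
    by rewrite -colE [RHS]mxE ME.
  by rewrite -mulmxA He -mulmxA Nv -scalemxAr -He mulmxA HH mul1mx !mxE andbT.
have Mblock : M = block_mx a%:M 0 0 (drsubmx M).
  rewrite -[LHS]submxK.
  have dl : dlsubmx M = 0.
    apply/matrixP => i j; rewrite (ord1 j) !mxE.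
    have := Me (rshift 1 i); rewrite mulr0 => <-; congr (M _ _).
    exact/val_inj.
  have ul : ulsubmx M = a%:M.
    apply/matrixP => i j; rewrite (ord1 j) (ord1 i) !mxE.
    have := Me 0; rewrite eqxx mulr1 => <-.
    by congr (M _ _); apply/val_inj.
  have ur : ursubmx M = 0.
    by rewrite -[LHS]trmxK trmx_ursub Msym dl trmx0.
  by rewrite dl ul ur.
have [|U [d [UU dE]]] := IH (drsubmx M); first by rewrite trmx_drsub Msym.
pose V : 'M[R]_(1 + n) := block_mx 1%:M 0 0 U.
have VV : V *m V^T = 1%:M.
  rewrite /V tr_block_mx mulmx_block !trmx0 trmx1 !(mulmx0, mul0mx, mulmx1).
  by rewrite !(addr0, add0r) UU -scalar_mx_block.
have VM : M = V^T *m diag_mx (row_mx a%:M d) *m V.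
  rewrite Mblock /V tr_block_mx diag_mx_row !mulmx_block.
  rewrite !trmx0 trmx1 !(mulmx0, mul0mx, mulmx1, mul1mx, addr0, add0r) -dE.
  by congr block_mx; apply/matrixP => i j; rewrite (ord1 i) (ord1 j) !mxE.
exists (V *m H), (row_mx a%:M d); split.
  by rewrite trmx_mul Hsym mulmxA -(mulmxA V) HH mulmx1.
have -> : N = H *m M *m H.
  by rewrite ME !mulmxA HH mul1mx -mulmxA HH mulmx1.
by rewrite trmx_mul Hsym VM !mulmxA.
Qed.

(** * Quadratic forms and positive definite matrices *)

Definition quad (R : realType) (n : nat) (M : 'M[R]_n) (v : 'cV[R]_n) : R :=
  (v^T *m M *m v) 0 0.

Lemma quadE (R : realType) (n : nat) (M : 'M[R]_n) (v : 'cV[R]_n) :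
  quad M v = \sum_i \sum_j M i j * (v i 0 * v j 0).
Proof.
rewrite /quad mxE exchange_big /=; apply: eq_bigr => j _.
by rewrite mxE mulr_suml; apply: eq_bigr => i _; rewrite mxE; ring.
Qed.

Lemma quadD (R : realType) (n : nat) (M N : 'M[R]_n) v :
  quad (M + N) v = quad M v + quad N v.
Proof. by rewrite /quad mulmxDr mulmxDl mxE. Qed.

Lemma quadZ (R : realType) (n : nat) a (M : 'M[R]_n) v :
  quad (a *: M) v = a * quad M v.
Proof. by rewrite /quad -scalemxAr -scalemxAl mxE. Qed.

Lemma quad_congr (R : realType) (n p : nat) (C : 'M[R]_(p, n)) (M : 'M[R]_p) v :
  quad (C^T *m M *m C) v = quad M (C *m v).
Proof. by rewrite /quad trmx_mul !mulmxA. Qed.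

Lemma posdef_ge0 (R : realType) (n : nat) (M : 'M[R]_n) v :
  posdef M -> 0 <= quad M v.
Proof.
move=> Mpos; have [->|v0] := eqVneq v 0; first by rewrite /quad mulmx0 mxE.
exact/ltW/Mpos.
Qed.

Lemma posdef_unit (R : realType) (n : nat) (M : 'M[R]_n) :
  posdef M -> M \in unitmx.
Proof.
move=> Mpos; rewrite unitmxE unitfE; apply/det0P => -[v v0 vM].
have := Mpos v^T; rewrite trmxK trmx_eq0 vM mul0mx mxE ltxx.
by move=> /(_ v0).
Qed.

Lemma posdef_invmx (R : realType) (n : nat) (M : 'M[R]_n) :
  M^T = M -> posdef M -> posdef (invmx M).
Proof.
move=> Msym Mpos v v0; have Mu := posdef_unit Mpos.
have := Mpos (invmx M *m v); rewrite trmx_mul trmx_inv Msym !mulmxA.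
rewrite mulmxKV //; apply; apply: contra_neq v0 => Mv.
by rewrite -[v](mulKVmx Mu) Mv mulmx0.
Qed.

(** Every column of [C] has zero [M]-energy, hence vanishes. *)
Lemma posdef_mulmx_eq0 (R : realType) (n p : nat) (M : 'M[R]_n)
    (C : 'M[R]_(n, p)) : posdef M -> C^T *m M *m C = 0 -> C = 0.
Proof.
move=> Mpos CMC; apply/matrixP => i j; rewrite [RHS]mxE.
have : quad M (C *m delta_mx j 0) = 0.
  by rewrite -quad_congr CMC /quad mulmx0 mul0mx mxE.
have [cj _|cj] := eqVneq (C *m delta_mx j (0 : 'I_1)) 0.
  by have := congr1 (fun X : 'cV_n => X i 0) cj; rewrite -colE !mxE.
by move=> H; have := Mpos _ cj; rewrite -/(quad M _) H ltxx.
Qed.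

Lemma quad_diag (R : realType) (n : nat) (d : 'rV[R]_n) v :
  quad (diag_mx d) v = \sum_i d 0 i * v i 0 ^+ 2.
Proof.
rewrite /quad mxE; apply: eq_bigr => i _; rewrite mul_mx_diag !mxE; ring.
Qed.

Lemma orthogonal_sqnorm (R : realType) (n : nat) (U : 'M[R]_n) (v : 'cV[R]_n) :
  U *m U^T = 1%:M -> \sum_i (U *m v) i 0 ^+ 2 = (v^T *m v) 0 0.
Proof.
move=> /mulmx1C UU.
have -> : v^T *m v = (U *m v)^T *m (U *m v).
  by rewrite trmx_mul mulmxA -(mulmxA v^T) UU mulmx1.
by rewrite [RHS]mxE; apply: eq_bigr => i _; rewrite [in RHS]mxE -expr2.
Qed.

(** * Square root, smallest eigenvalue and pseudoinverse from the spectral theorem *)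

Lemma spd_sqrtP (R : realType) (n : nat) (M : 'M[R]_n) :
  M^T = M -> posdef M ->
  [/\ (spd_sqrt M)^T = spd_sqrt M, posdef (spd_sqrt M) &
      spd_sqrt M *m spd_sqrt M = M].
Proof.
move=> Msym Mpos; apply: (@xgetPex _ 0 [set X : 'M[R]_n |
  [/\ X^T = X, posdef X & X *m X = M]]).
have [U [d [UU ME]]] := symmetric_spectral Msym.
have UU' := mulmx1C UU.
(* Each eigenvalue is the value of the form at the corresponding row of [U], transposed. *)
have d0 i : 0 < d 0 i.
  have := Mpos (U^T *m delta_mx i 0); rewrite -/(quad M _) ME quad_congr.
  rewrite mulmxA UU mul1mx quad_diag (bigD1 i) //= big1 => [|j ji].
    rewrite mxE !eqxx expr1n mulr1 addr0; apply.
    apply/eqP => /(congr1 (mulmx U)); rewrite mulmxA UU mul1mx mulmx0.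
    by move=> /matrixP/(_ i 0)/eqP; rewrite !mxE !eqxx oner_eq0.
  by rewrite mxE (negPf ji) expr0n mulr0.
pose e : 'rV_n := \row_i (Num.sqrt (d 0 i)).
exists (U^T *m diag_mx e *m U); split => /=.
- by rewrite !trmx_mul trmxK tr_diag_mx mulmxA.
- move=> v v0; rewrite -/(quad _ v) quad_congr quad_diag.
  have e0 i : 0 < e 0 i by rewrite mxE sqrtr_gt0.
  rewrite lt_def sumr_ge0 ?andbT => [|i _]; last first.
    by rewrite mulr_ge0 ?sqr_ge0 // ltW.
  apply: contra_neq v0 => /eqP.
  rewrite psumr_eq0 => [/allP H|i _]; last first.
    by rewrite mulr_ge0 ?sqr_ge0 // ltW.
  rewrite -[v]mul1mx -UU' -mulmxA; suff -> : U *m v = 0 by rewrite mulmx0.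
  apply/matrixP => i j; rewrite (ord1 j) [RHS]mxE.
  have := H i (mem_index_enum i); rewrite mulf_eq0 gt_eqF //= sqrf_eq0.
  by move/eqP.
- rewrite !mulmxA -(mulmxA _ U) UU mulmx1 -(mulmxA U^T) mulmx_diag ME.
  congr (_ *m diag_mx _ *m _); apply/matrixP => i j.
  by rewrite !mxE (ord1 i) -expr2 sqr_sqrtr // ltW.
Qed.

(** The least diagonal entry satisfies the Rayleigh bound after an orthogonal change of variables.
    Testing that bound on eigenvectors shows that this entry is the least eigenvalue, so it is the
    value picked by [xget]. *)
Lemma lambda_minP (R : realType) (n : nat) (N : 'M[R]_n) :
  (0 < n)%N -> N^T = N ->
  eigenvalue N (lambda_min N) /\
  forall v, lambda_min N * (v^T *m v) 0 0 <= quad N v.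
Proof.
case: n N => // n N _ Nsym.
have [U [d [UU NE]]] := symmetric_spectral Nsym.
pose i0 := [arg min_(i < ord0 : 'I_n.+1) d 0 i]%O.
have di0 j : d 0 i0 <= d 0 j.
  by rewrite /i0; case: Order.TotalTheory.arg_minP => // i _; apply.
have Nquad v : d 0 i0 * (v^T *m v) 0 0 <= quad N v.
  rewrite -(orthogonal_sqnorm v UU) NE quad_congr quad_diag mulr_sumr.
  by apply: ler_sum => i _; rewrite ler_wpM2r ?sqr_ge0.
have Nd : eigenvalue N (d 0 i0).
  apply/eigenvalueP; exists (row i0 U).
    rewrite NE !mulmxA -row_mul UU row1 -rowE row_diag_mx.
    by rewrite -scalemxAl -rowE.
  apply/eqP => U0; have : row i0 U *m U^T = 0 by rewrite U0 mul0mx.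
  rewrite -row_mul UU row1 => /matrixP/(_ 0 i0) /eqP.
  by rewrite !mxE !eqxx oner_eq0.
have Nmin c : eigenvalue N c -> d 0 i0 <= c.
  move=> /eigenvalueP[u uN u0]; have := Nquad u^T.
  rewrite /quad trmxK uN -scalemxAl [X in _ <= X]mxE ler_pM2r //.
  have := trmx_mul_ge0 u^T; rewrite le_eqVlt eq_sym trmx_mul_eq0 trmx_eq0.
  by rewrite (negPf u0) trmxK.
have [lmE lmin] : eigenvalue N (lambda_min N) /\
    forall c, eigenvalue N c -> lambda_min N <= c.
  by apply: (@xgetPex _ 0 [set a |
    eigenvalue N a /\ forall c, eigenvalue N c -> a <= c]); exists (d 0 i0).
have -> : lambda_min N = d 0 i0 by apply/le_anti; rewrite lmin // Nmin.
by [].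
Qed.

(** The spectral theorem provides a solution of the Penrose equations; symmetry and commutation are
    then deduced from these equations for whichever solution [xget] returns. *)
Lemma mpinv_symP (R : realType) (n : nat) (M : 'M[R]_n) : M^T = M ->
  [/\ M *m mpinv M *m M = M, mpinv M *m M *m mpinv M = mpinv M,
      M *m mpinv M = mpinv M *m M & (mpinv M)^T = mpinv M].
Proof.
move=> Msym.
have [] : is_mpinv M (mpinv M).
  apply: (@xgetPex _ 0 [set X | is_mpinv M X]).
  have [U [d [UU ME]]] := symmetric_spectral Msym.
  (* Since the inverse of 0 is 0, this inverts exactly the nonzero eigenvalues. *)
  pose e : 'rV[R]_n := \row_i (d 0 i)^-1.
  exists (U^T *m diag_mx e *m U); rewrite /is_mpinv.
  have mulE (x y : 'rV[R]_n) : (U^T *m diag_mx x *m U) *m (U^T *m diag_mx y *m U)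
      = U^T *m diag_mx (\row_j (x 0 j * y 0 j)) *m U.
    by rewrite !mulmxA -(mulmxA _ U) UU mulmx1 -(mulmxA U^T) mulmx_diag.
  have trE (x : 'rV[R]_n) : (U^T *m diag_mx x *m U)^T = U^T *m diag_mx x *m U.
    by rewrite !trmx_mul trmxK tr_diag_mx mulmxA.
  rewrite /= ME !mulE !trE; split => //.
    congr (_ *m diag_mx _ *m _); apply/matrixP => i j; rewrite !mxE ?(ord1 i).
    have [->|dj] := eqVneq (d 0 j) 0; first by rewrite !mulr0.
    by rewrite mulfV // mul1r.
  congr (_ *m diag_mx _ *m _); apply/matrixP => i j; rewrite !mxE ?(ord1 i).
  have [->|dj] := eqVneq (d 0 j) 0; first by rewrite invr0 !mulr0.
  by rewrite mulVf // mul1r.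
move: (mpinv M) => X MXM XMX MXs XMs.
have sX : X^T *m M = M *m X by rewrite -MXs trmx_mul Msym.
have sX' : M *m X^T = X *m M by rewrite -XMs trmx_mul Msym.
have MXTM : M *m X^T *m M = M.
  by have := congr1 trmx MXM; rewrite !trmx_mul Msym mulmxA.
(* Both sides are symmetric, the right one being [X *m M]. Transposing
   [M *m X = M *m X^T *m (M *m X)] gives [M *m X *m M *m X^T], which collapses to [M *m X^T]. *)
have MXX : M *m X = M *m X^T.
  have E : M *m X = M *m X^T *m (M *m X) by rewrite mulmxA MXTM.
  by have := congr1 trmx E; rewrite MXs trmx_mul MXs sX' XMs -sX' mulmxA MXM.
have comm : M *m X = X *m M by rewrite MXX.
have Xs : X^T = X.
  have := congr1 trmx XMX; rewrite !trmx_mul Msym mulmxA sX comm -mulmxA.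
  by rewrite -MXX mulmxA XMX => <-.
by split.
Qed.

(** * The matrix Z of one sketch and its rational regularization *)

Section SketchProjection.
Variables (R : realType) (n q : nat) (B : 'M[R]_n) (Y : 'M[R]_(n, q)).
Hypotheses (Bsym : B^T = B) (Bpos : posdef B).

Let W := invmx B.
Let X := mpinv (Y^T *m W *m Y).

(** This is Z for [Y = A^T *m S]; [W *m projZ] is the [B]-orthogonal projection onto the range of
    [W *m Y]. *)
Definition projZ : 'M[R]_n := Y *m X *m Y^T.

Let Bunit : B \in unitmx. Proof. exact: posdef_unit. Qed.

Let Wsym : W^T = W. Proof. by rewrite /W trmx_inv Bsym. Qed.

Let Wpos : posdef W. Proof. exact: posdef_invmx. Qed.

Let Msym : (Y^T *m W *m Y)^T = Y^T *m W *m Y.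
Proof. by rewrite !trmx_mul trmxK Wsym mulmxA. Qed.

(** The Penrose equation only gives this after multiplication by [Y^T *m W]; positive definiteness
    of [W] allows the cancellation, applied to the difference of the two sides. *)
Let XM_Y : Y *m X *m (Y^T *m W *m Y) = Y.
Proof.
have [MXM XMX MX Xs] := mpinv_symP Msym.
apply/esym/eqP; rewrite -subr_eq0; apply/eqP; apply: (posdef_mulmx_eq0 Wpos).
set M := Y^T *m W *m Y in MXM *.
have -> : Y - Y *m X *m M = Y *m (1%:M - X *m M).
  by rewrite mulmxBr mulmx1 (mulmxA Y X M).
rewrite (_ : _ *m _ *m _ = (1%:M - X *m M)^T *m (M *m (1%:M - X *m M))); last first.
  by rewrite trmx_mul /M !mulmxA.
suff -> : M *m (1%:M - X *m M) = 0 by rewrite mulmx0.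
by rewrite mulmxBr mulmx1 (mulmxA M X M) MXM subrr.
Qed.

Lemma projZ_sym : projZ^T = projZ.
Proof.
have [_ _ _ Xs] := mpinv_symP Msym.
by rewrite /projZ !trmx_mul trmxK Xs mulmxA.
Qed.

Lemma projZ_idem : projZ *m W *m projZ = projZ.
Proof.
have -> : projZ *m W *m projZ = Y *m X *m (Y^T *m W *m Y) *m (X *m Y^T).
  by rewrite /projZ !mulmxA.
by rewrite XM_Y mulmxA.
Qed.

Lemma projZ_ge0 v : 0 <= quad projZ v.
Proof.
by rewrite -projZ_idem -{1}projZ_sym quad_congr posdef_ge0.
Qed.

(** Pythagoras for the [B]-orthogonal projection [W *m projZ]. *)
Lemma quad_step v :
  quad B (v - W *m projZ *m v) = quad B v - quad projZ v.
Proof.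
have -> : v - W *m projZ *m v = (1%:M - W *m projZ) *m v.
  by rewrite mulmxBl mul1mx.
rewrite -quad_congr [(1%:M - _)^T]linearB /= trmx1 trmx_mul projZ_sym Wsym.
have -> : (1%:M - projZ *m W) *m B = B - projZ.
  by rewrite mulmxBl mul1mx mulmxKV.
have -> : (B - projZ) *m (1%:M - W *m projZ) = B + (-1) *: projZ.
  rewrite mulmxBr mulmx1 mulmxBl mulKVmx // mulmxA projZ_idem subrr subr0.
  by rewrite scaleN1r.
by rewrite quadD quadZ mulN1r.
Qed.

Lemma projZ_le v : quad projZ v <= quad B v.
Proof. by rewrite -subr_ge0 -quad_step posdef_ge0. Qed.

Let K := Y *m Y^T.

Let gram_ge0 v : 0 <= quad K v.
Proof.
rewrite /K -[Y in Y *m _]trmxK -[Y^T^T]mulmx1 quad_congr /quad mulmx1.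
exact: trmx_mul_ge0.
Qed.

Lemma regularized_posdef eps : 0 < eps -> posdef (K + eps *: B).
Proof.
move=> eps0 v v0.
by rewrite -/(quad _ v) quadD quadZ ltr_wpDl // mulr_gt0 // Bpos.
Qed.

(* [regF eps] is rational in [K = Y Y^T] and tends to [projZ] as [eps] tends to
   0; this gives the measurability of [projZ], which is not continuous in [Y]. *)
Definition regF eps : 'M[R]_n := K *m invmx (K + eps *: B) *m B.

Let Ksym : K^T = K. Proof. by rewrite /K trmx_mul trmxK. Qed.

Let regularized_sym eps : (K + eps *: B)^T = K + eps *: B.
Proof. by rewrite [LHS]linearD /= trmxZ Bsym Ksym. Qed.

(** Substitute [K = (K + eps *: B) - eps *: B]. In this form the symmetry and the upper bound by [B]
    are visible. *)
Let regFE eps : 0 < eps ->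
  regF eps = B - eps *: (B^T *m invmx (K + eps *: B) *m B).
Proof.
move=> eps0; have Ku := posdef_unit (regularized_posdef eps0).
apply/(canRL (addrK _)); rewrite /regF scalemxAl scalemxAl Bsym -!mulmxDl.
by rewrite mulmxV // mul1mx.
Qed.

Lemma regF_sym eps : 0 < eps -> (regF eps)^T = regF eps.
Proof.
move=> eps0; rewrite regFE // [LHS]linearB /= trmxZ !trmx_mul trmx_inv.
by rewrite regularized_sym trmxK Bsym mulmxA.
Qed.

Lemma regF_bounds eps v : 0 < eps -> 0 <= quad (regF eps) v <= quad B v.
Proof.
move=> eps0; have Hpos := regularized_posdef eps0; have Ku := posdef_unit Hpos.
have Hsym := regularized_sym eps; have FE := regFE eps0.
set H := K + eps *: B in Hpos Ku Hsym FE.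
apply/andP; split; last first.
  rewrite FE quadD -scaleNr quadZ mulNr gerBl mulr_ge0 ?(ltW eps0) // quad_congr.
  by rewrite posdef_ge0 //; apply: posdef_invmx.
(* In this variable [v = W *m (H *m u)] and [regF eps *m v = K *m u], so the form becomes that of
   [H *m W *m K], a sum of two nonnegative ones. *)
pose u := invmx H *m (B *m v).
have -> : quad (regF eps) v = quad (K *m W *m K) u + eps * quad K u.
  have vE : v = W *m (H *m u) by rewrite /u mulKVmx // mulKmx.
  have Fv : regF eps *m v = K *m u by rewrite /regF /u !mulmxA.
  have HWK : H *m W *m K = K *m W *m K + eps *: K.
    by rewrite /H !mulmxDl -!scalemxAl mulmxV // mul1mx.
  rewrite -quadZ -quadD -HWK /quad -mulmxA Fv vE !trmx_mul Wsym Hsym.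
  by rewrite !mulmxA.
rewrite -{1}Ksym quad_congr addr_ge0 ?(posdef_ge0 _ Wpos) //.
by rewrite mulr_ge0 ?(ltW eps0) // gram_ge0.
Qed.

(** An error formula with [L] independent of [eps]: as [regF eps] is bounded by [B], the difference
    is of order [eps]. *)
Lemma regF_projZ : exists L : 'M[R]_n, forall eps, 0 < eps ->
  projZ = regF eps + eps *: (L *m regF eps).
Proof.
have [MXM XMX MX Xs] := mpinv_symP Msym.
(* Chosen so that [L *m K = projZ]. With [projZ *m W *m K = K] this turns [K + eps *: (L *m K)] into
   [projZ *m W *m (K + eps *: B)], whose last factor cancels the inverse. *)
exists (Y *m X *m X *m Y^T *m W) => eps eps0.
set L := (X in X *m regF _).
have Ku := posdef_unit (regularized_posdef eps0).
have LK : L *m K = projZ.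
  have -> : L *m K = Y *m (X *m (X *m (Y^T *m W *m Y))) *m Y^T.
    by rewrite /L /K !mulmxA.
  by rewrite -/X in MX; rewrite -MX [X *m (_ *m X)]mulmxA XMX.
have ZWK : projZ *m W *m K = K.
  have -> : projZ *m W *m K = Y *m X *m (Y^T *m W *m Y) *m Y^T.
    by rewrite /projZ /K !mulmxA.
  by rewrite XM_Y.
have E : K + eps *: (L *m K) = projZ *m W *m (K + eps *: B).
  by rewrite mulmxDr ZWK LK -scalemxAr mulmxKV.
have -> : regF eps + eps *: (L *m regF eps) =
    (K + eps *: (L *m K)) *m invmx (K + eps *: B) *m B.
  rewrite /regF !mulmxDl -!scalemxAl (mulmxA L) (mulmxA L K).
  by [].
by rewrite E mulmxK // mulmxKV.
Qed.

End SketchProjection.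

(** Nonnegativity at the sum and the difference of two basis vectors bounds twice the entry by
    [N i i + N j j], and the diagonal of [N] lies below that of [B]. *)
Lemma sym_entry_bound (R : realType) (n : nat) (N B : 'M[R]_n) :
  N^T = N -> (forall v, 0 <= quad N v <= quad B v) ->
  forall i j, `|N i j| <= B i i + B j j.
Proof.
move=> Nsym NB i j.
pose e (k : 'I_n) : 'cV[R]_n := delta_mx k 0.
have ent (M : 'M[R]_n) k l : ((e k)^T *m M *m e l) 0 0 = M k l.
  by rewrite /e trmx_delta -rowE -colE !mxE.
have /andP[Ni0 NBi] := NB (e i); have /andP[Nj0 NBj] := NB (e j).
have addE (C D : 'M[R]_1) : (C + D) 0 0 = C 0 0 + D 0 0 by rewrite mxE.
have scaleE c (C : 'M[R]_1) : (c *: C) 0 0 = c * C 0 0 by rewrite mxE.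
have Nij : N j i = N i j by rewrite -[in LHS]Nsym mxE.
have quadN c : quad N (e i + c *: e j) = N i i + 2 * c * N i j + c ^+ 2 * N j j.
  rewrite /quad [(e i + _)^T]linearD /= trmxZ !(mulmxDl, mulmxDr).
  by rewrite -!(scalemxAl, scalemxAr) !(addE, scaleE) !ent Nij; ring.
have /andP[+ _] := NB (e i + 1 *: e j); have /andP[+ _] := NB (e i + (-1) *: e j).
move: Ni0 NBi Nj0 NBj; rewrite !quadN /quad !ent sqrrN expr1n => *.
rewrite ler_norml; apply/andP; split; lra.
Qed.

(** * Measurability of Z as a function of the sketch *)

(** Inversion is written as x times the power -1 of its square, which reduces it to a measurable
    power of a nonnegative base; both expressions are 0 at 0. *)
Lemma measurable_funV d (T : measurableType d) (R : realType) (f : T -> R) :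
  measurable_fun setT f -> measurable_fun setT (fun x => (f x)^-1).
Proof.
move=> mf; rewrite (_ : (fun _ => _) = (fun x => f x * (f x ^+ 2) `^ (-1))).
  apply: measurable_funM => //.
  apply: (measurableT_comp (measurable_powR _)).
  exact: measurable_funX.
apply/funext => x; rewrite powR_inv1 ?sqr_ge0 //.
have [->|fx] := eqVneq (f x) 0; first by rewrite invr0 mul0r.
by rewrite expr2 invfM mulrA mulfV // mul1r.
Qed.

Definition measurable_mx d (T : measurableType d) (R : realType) (p q : nat)
    (M : T -> 'M[R]_(p, q)) : Prop :=
  forall i j, measurable_fun setT (fun x => M x i j).

Section MeasurableMatrix.
Context d (T : measurableType d) (R : realType).

Lemma measurable_cst_mx p q (C : 'M[R]_(p, q)) : measurable_mx (fun _ : T => C).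
Proof. by move=> i j; exact: measurable_cst. Qed.

Lemma measurable_addmx p q (M N : T -> 'M[R]_(p, q)) :
  measurable_mx M -> measurable_mx N -> measurable_mx (fun x => M x + N x).
Proof.
move=> mM mN i j; under eq_fun do rewrite mxE.
exact: measurable_funD.
Qed.

Lemma measurable_mulmx p q r (M : T -> 'M[R]_(p, q)) (N : T -> 'M[R]_(q, r)) :
  measurable_mx M -> measurable_mx N -> measurable_mx (fun x => M x *m N x).
Proof.
move=> mM mN i j; under eq_fun do rewrite mxE.
by apply: measurable_sum => k; apply: measurable_funM.
Qed.

Lemma measurable_det n (M : T -> 'M[R]_n) :
  measurable_mx M -> measurable_fun setT (fun x => \det (M x)).
Proof.
move=> mM; rewrite /determinant; apply: measurable_sum => s.
by apply: measurable_funM => //; apply: measurable_prod.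
Qed.

Lemma measurable_invmx n (M : T -> 'M[R]_n) :
  (forall x, M x \in unitmx) ->
  measurable_mx M -> measurable_mx (fun x => invmx (M x)).
Proof.
move=> Mu mM i j; rewrite /invmx; under eq_fun do rewrite Mu !mxE.
apply: measurable_funM; first exact/measurable_funV/measurable_det.
apply: measurable_funM => //; apply: measurable_det => k l.
under eq_fun do rewrite !mxE; exact: mM.
Qed.

Lemma measurable_mx_cvg p q (F : nat -> T -> 'M[R]_(p, q)) (M : T -> 'M[R]_(p, q)) :
  (forall k, measurable_mx (F k)) ->
  (forall i j x, (fun k => F k x i j) @ \oo --> M x i j) -> measurable_mx M.
Proof.
move=> mF FM i j; apply: (@measurable_fun_cvg _ _ _ _ (fun k x => F k x i j)).
  by move=> k; exact: mF.
by move=> x _; exact: FM.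
Qed.

End MeasurableMatrix.

Section SketchMeasurability.
Context (R : realType) (m : nat).

(** Padding by zero columns lets one countable family of real functions read sketches of every
    width. *)
Definition sketch_coef (i : 'I_m) (k : nat) (s : sketch R m) : R :=
  if insub k is Some j then tagged s i j else 0.

(** Among sketches of a fixed width the coefficient is either a true entry, whose preimages are
    generators, or constantly 0. *)
Lemma measurable_sketch_coef i k : measurable_fun setT (sketch_coef i k).
Proof.
move=> _ Y mY; rewrite setTI.
have -> : sketch_coef i k @^-1` Y =
    \bigcup_q [set s | tag s = q /\ Y (sketch_coef i k s)].
  apply/seteqP; split => [s Ys|s [q _ [_ //]]].
  by exists (tag s).
apply: bigcupT_measurable => q.
rewrite /sketch_coef; case E : (insub k : option 'I_q) => [j|].
  apply: sub_sigma_algebra; right; exists q, i, j, Y; split => //.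
  apply/seteqP; split => [[q' M] /= [qq]|_ [M YM <-]] /=.
    by subst q'; rewrite E => YM; exists M.
  by rewrite E; split.
have [Y0|Y0] := pselect (Y 0).
  apply: sub_sigma_algebra; left; exists q.
  apply/seteqP; split => [[q' M] /= [qq] //|[q' M] /= qq].
  by subst q'; rewrite E.
rewrite (_ : mkset _ = set0) ?measurable0 //.
by apply/seteqP; split => [[q' M] /= [qq]|//]; subst q'; rewrite E.
Qed.

(** The Gram matrix has the same size for all widths; its entries are limits of padded sums that
    become constant once [N] reaches the width. *)
Lemma measurable_sketch_gram :
  measurable_mx (fun s : sketch R m => tagged s *m (tagged s)^T).
Proof.
apply: (@measurable_mx_cvg _ _ _ _ _ (fun N s =>
  \matrix_(i, l) \sum_(k < N) sketch_coef i k s * sketch_coef l k s)).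
  move=> N i l; under eq_fun do rewrite mxE.
  by apply: measurable_sum => k; apply: measurable_funM;
    exact: measurable_sketch_coef.
move=> i l [q M]; apply: cvg_near_cst; exists q => // N /= qN.
rewrite !mxE -(subnKC qN) big_split_ord /= [X in _ + X]big1 ?addr0 => [|k _].
  apply: eq_bigr => k _; rewrite !mxE /sketch_coef /=.
  by rewrite insubT //= => kq; congr (M _ _ * M _ _); apply: val_inj.
by rewrite /sketch_coef insubF ?mul0r //= ltnNge leq_addr.
Qed.

Lemma sketchZE n (A : 'M[R]_(m, n)) (B : 'M[R]_n) s :
  sketchZ A B s = projZ B (A^T *m tagged s).
Proof. by rewrite /sketchZ /projZ !trmx_mul trmxK !mulmxA. Qed.

Context (n : nat) (A : 'M[R]_(m, n)) (B : 'M[R]_n).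
Hypotheses (Bsym : B^T = B) (Bpos : posdef B).

Lemma sketchZ_bound s i j : `|sketchZ A B s i j| <= B i i + B j j.
Proof.
rewrite sketchZE; apply: sym_entry_bound; first exact: projZ_sym.
by move=> v; rewrite projZ_ge0 // projZ_le.
Qed.

Lemma measurable_sketchZ : measurable_mx (sketchZ A B).
Proof.
pose F (k : nat) (s : sketch R m) := regF B (A^T *m tagged s) k.+1%:R^-1.
apply: (@measurable_mx_cvg _ _ _ _ _ F).
  move=> k; rewrite /F /regF.
  have mK : measurable_mx (fun s : sketch R m =>
      A^T *m tagged s *m (A^T *m tagged s)^T).
    have := measurable_mulmx (measurable_mulmx (measurable_cst_mx A^T)
      measurable_sketch_gram) (measurable_cst_mx A).
    congr measurable_mx; apply/funext => s.
    by rewrite trmx_mul trmxK !mulmxA.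
  apply: measurable_mulmx; last exact: measurable_cst_mx.
  apply: measurable_mulmx => //; apply: measurable_invmx.
    by move=> s; apply/posdef_unit/regularized_posdef.
  exact: measurable_addmx mK (measurable_cst_mx _).
move=> i j s; rewrite sketchZE.
have [L LE] := regF_projZ (A^T *m tagged s) Bsym Bpos.
(* Bounds entry (i, j) of [L *m regF eps] uniformly in [eps], by the entry bound for matrices
   between 0 and [B]. *)
pose C := \sum_l `|L i l| * (B l l + B j j).
apply/cvgrPdist_le => e e0.
have : (fun k => k.+1%:R^-1 * C) @ \oo --> (0 : R).
  rewrite -[X in _ --> X](mul0r C); apply: cvgMl.
  exact: cvg_harmonic.
move=> /cvgrPdist_le/(_ e e0); apply: filterS => k.
rewrite sub0r normrN => le_e.
have k0 : 0 < k.+1%:R^-1 :> R by rewrite invr_gt0.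
rewrite (LE _ k0) mxE [X in `|X|]addrC addKr mxE normrM.
apply: le_trans (le_trans (ler_norm _) le_e).
rewrite gtr0_norm // ler_pM2l // mxE.
apply: le_trans (ler_norm_sum _ _ _) _; apply: ler_sum => l _.
rewrite normrM ler_wpM2l // sym_entry_bound //; first exact: regF_sym.
by move=> v; exact: regF_bounds.
Qed.

End SketchMeasurability.

(** * Bounded measurable functions and their real expectations *)

Definition bounded_measurable d (T : measurableType d) (R : realType)
    (f : T -> R) : Prop :=
  measurable_fun setT f /\ exists C, forall x, `|f x| <= C.

Section BoundedMeasurable.
Context d (T : measurableType d) (R : realType).
Implicit Types f g : T -> R.
Local Notation bm := (@bounded_measurable d T R).

Lemma bm_cst (c : R) : bm (fun _ => c).
Proof. by split; [exact: measurable_cst|exists `|c|]. Qed.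

Lemma bmD f g : bm f -> bm g -> bm (fun x => f x + g x).
Proof.
move=> [mf [C fC]] [mg [D gD]]; split; first exact: measurable_funD.
by exists (C + D) => x; rewrite (le_trans (ler_normD _ _)) // lerD.
Qed.

Lemma bmM f g : bm f -> bm g -> bm (fun x => f x * g x).
Proof.
move=> [mf [C fC]] [mg [D gD]]; split; first exact: measurable_funM.
by exists (C * D) => x; rewrite normrM ler_pM.
Qed.

Lemma bmZ c f : bm f -> bm (fun x => c * f x).
Proof. exact/bmM/bm_cst. Qed.

Lemma bmB f g : bm f -> bm g -> bm (fun x => f x - g x).
Proof.
move=> bf bg; under eq_fun do rewrite -mulN1r.
by apply: bmD => //; apply: bmZ.
Qed.

Lemma bm_sum (I : Type) (r : seq I) (F : I -> T -> R) :
  (forall i, bm (F i)) -> bm (fun x => \sum_(i <- r) F i x).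
Proof.
move=> bF; elim: r => [|i r IH]; under eq_fun do rewrite ?big_nil ?big_cons.
  exact: bm_cst.
exact: bmD.
Qed.

Lemma bm_prod (I : Type) (r : seq I) (F : I -> T -> R) :
  (forall i, bm (F i)) -> bm (fun x => \prod_(i <- r) F i x).
Proof.
move=> bF; elim: r => [|i r IH]; under eq_fun do rewrite ?big_nil ?big_cons.
  exact: bm_cst.
exact: bmM.
Qed.

Lemma bm_indic (V : set T) : measurable V -> bm (\1_V : T -> R).
Proof.
move=> mV; split; first exact: measurable_indic.
by exists 1 => x; rewrite indicE; case: (_ \in _); rewrite ?normr1 ?normr0.
Qed.

(* The approximant is the discretized layer-cake formula
   [f + C ~ e * #{j | (j + 1) e <= f + C}]. *)
Lemma bm_simple_approx f (e : R) : bm f -> 0 < e ->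
  exists (N : nat) (c : nat -> R) (V : nat -> set T),
    (forall j, measurable (V j)) /\
    forall x, `|f x - \sum_(j < N) c j * \1_(V j) x| <= e.
Proof.
move=> [mf [C fC]] e0.
pose V (j : nat) := if j is j'.+1 then [set x | j'.+1%:R * e <= f x + C] else setT.
pose N := (Num.trunc ((C + C) / e)).+1.
(* Index 0 carries the constant [- C] on the whole space; the [N] layers follow, enough because
   [f + C] is at most [C + C]. *)
exists N.+1, (fun j => if j is 0%N then - C else e), V; split.
  case=> [|j] /=; first exact: measurableT.
  have mfC : measurable_fun setT (fun x => f x + C).
    by apply: measurable_funD => //; exact: measurable_cst.
  rewrite -[X in measurable X]setTI.
  have := mfC measurableT _ (measurable_itv `[j.+1%:R * e, +oo[).
  congr measurable; congr (_ `&` _).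
  by apply/seteqP; split => x /=; rewrite in_itv /= andbT.
move=> x; rewrite big_ord_recl /= indicT mulr1 opprD opprK addrA.
have /ler_normlP[] := fC x; rewrite lerNl => fl fu.
have y0 : 0 <= (f x + C) / e by rewrite divr_ge0 ?(ltW e0) //; lra.
have yN : (Num.trunc ((f x + C) / e) <= N)%N.
  by rewrite leqW // Num.Theory.le_truncn // ler_pM2r ?invr_gt0 // lerD2r.
have -> : \sum_(i < N) e * \1_[set x0 | i.+1%:R * e <= f x0 + C] x =
    e * (Num.trunc ((f x + C) / e))%:R.
  rewrite -mulr_sumr; congr (_ * _).
  rewrite -(subnKC yN) big_split_ord /= [X in _ + X]big1 ?addr0 => [|i _].
    rewrite -[LHS]/(\sum_(i < _) _) (eq_bigr (fun=> 1)) => [|i _].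
      by rewrite sumr_const card_ord.
    rewrite indicE mem_set //= -ler_pdivlMr // -truncn_ge_nat //.
  rewrite indicE memNset //= -ler_pdivlMr // -truncn_ge_nat //.
  by apply/negP; rewrite -ltnNge ltnS leq_addr.
have /andP[] := truncn_itv y0.
rewrite ler_pdivlMr // ltr_pdivrMr // -natr1.
set t := (Num.trunc _)%:R; rewrite mulrDl => H1 H2.
by rewrite ger0_norm; lra.
Qed.

End BoundedMeasurable.

Section RealExpectation.
Context d (T : measurableType d) (R : realType) (P : probability T R).
Implicit Types f g : T -> R.
Local Notation bm := (@bounded_measurable d T R).

Definition Ex (f : T -> R) : R := \int[P]_x f x.

Lemma bm_integrable f : bm f -> P.-integrable setT (EFin \o f).
Proof.
move=> [mf [C fC]]; apply: measurable_bounded_integrable => //.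
  by apply: (le_lt_trans (probability_le1 P measurableT)); rewrite ltry.
exists C; split; first exact: num_real.
by move=> M CM x _; rewrite /= (le_trans (fC x)) // ltW.
Qed.

Lemma ExE f : bm f -> (\int[P]_x (f x)%:E)%E = (Ex f)%:E.
Proof.
move=> bf; rewrite /Ex /Rintegral fineK //.
exact/integrable_fin_num/bm_integrable.
Qed.

Lemma Ex_cst c : Ex (fun _ => c) = c.
Proof.
transitivity (c * fine (P setT)); first exact: Rintegral_cst.
by rewrite probability_setT mulr1.
Qed.

Lemma ExD f g : bm f -> bm g -> Ex (fun x => f x + g x) = Ex f + Ex g.
Proof. by move=> bf bg; rewrite /Ex RintegralD //; apply: bm_integrable. Qed.

Lemma ExZ c f : bm f -> Ex (fun x => c * f x) = c * Ex f.
Proof. by move=> bf; rewrite /Ex RintegralZl //; apply: bm_integrable. Qed.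

Lemma ExB f g : bm f -> bm g -> Ex (fun x => f x - g x) = Ex f - Ex g.
Proof. by move=> bf bg; rewrite /Ex RintegralB //; apply: bm_integrable. Qed.

Lemma Ex_sum (I : Type) (r : seq I) (F : I -> T -> R) :
  (forall i, bm (F i)) ->
  Ex (fun x => \sum_(i <- r) F i x) = \sum_(i <- r) Ex (F i).
Proof.
move=> bF; elim: r => [|i r IH].
  by under [in LHS]eq_fun do rewrite big_nil; rewrite Ex_cst big_nil.
under [in LHS]eq_fun do rewrite big_cons.
by rewrite ExD ?IH ?big_cons //; apply: bm_sum.
Qed.

Lemma Ex_le f g : bm f -> bm g -> (forall x, f x <= g x) -> Ex f <= Ex g.
Proof.
by move=> bf bg fg; rewrite /Ex le_Rintegral //; apply: bm_integrable.
Qed.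

Lemma Ex_norm_le f c : bm f -> (forall x, `|f x| <= c) -> `|Ex f| <= c.
Proof.
move=> bf fc; rewrite ler_norml; apply/andP; split.
  rewrite -[X in X <= _]Ex_cst; apply: Ex_le => // [|x]; first exact: bm_cst.
  by have /ler_normlP[] := fc x; rewrite lerNl.
rewrite -[X in _ <= X]Ex_cst; apply: Ex_le => // [|x]; first exact: bm_cst.
by have /ler_normlP[] := fc x.
Qed.

Lemma Ex_indic (V : set T) : measurable V -> Ex \1_V = fine (P V).
Proof. by move=> mV; rewrite /Ex /Rintegral integral_indic // setIT. Qed.

Context d' (E : measurableType d').

Lemma bm_comp (h : E -> R) (Y : {RV P >-> E}) :
  bounded_measurable h -> bm (fun w => h (Y w)).
Proof.
move=> [mh [C hC]]; split; last by exists C.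
exact: (measurableT_comp mh).
Qed.

(** One statement for two uses: independence takes [Y = Y'], equality of laws takes [H] and [c]
    equal to 1. *)
Lemma bounded_factor (Y Y' : {RV P >-> E}) (H : T -> R) (c : R) : bm H ->
  (forall V, measurable V ->
    Ex (fun w => \1_V (Y w) * H w) = Ex (fun w => \1_V (Y' w)) * c) ->
  forall h : E -> R, bounded_measurable h ->
    Ex (fun w => h (Y w) * H w) = Ex (fun w => h (Y' w)) * c.
Proof.
move=> bH HV h bh; have [_ [K HK]] := bH.
apply/eqP; rewrite -subr_eq0 -normr_eq0; apply/eqP/le_anti.
rewrite normr_ge0 andbT; apply/ler_addgt0Pr => e e0; rewrite add0r.
(* Replacing [h] by a simple function within [e / D] costs at most [e / D] times [|K|] on the left
   and [|c|] on the right; the 1 keeps [D] positive. *)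
pose D := `|K| + `|c| + 1.
have D0 : 0 < D by rewrite /D ltr_pwDr // addr_ge0.
have [N [a [V [mV hV]]]] := bm_simple_approx bh (divr_gt0 e0 D0).
pose g x := \sum_(j < N) a j * \1_(V j) x.
have {}hV x : `|h x - g x| <= e / D := hV x.
have bV j : bounded_measurable (\1_(V j) : E -> R) by exact: bm_indic.
have bg : bounded_measurable g.
  by apply: bm_sum => j; apply: bmZ.
have bgY (Z : {RV P >-> E}) : bm (fun w => g (Z w)) by exact: bm_comp.
have bhY (Z : {RV P >-> E}) : bm (fun w => h (Z w)) by exact: bm_comp.
have bVY j (Z : {RV P >-> E}) : bm (fun w => \1_(V j) (Z w)) by exact: bm_comp.
have gE : Ex (fun w => g (Y w) * H w) = Ex (fun w => g (Y' w)) * c.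
  transitivity (Ex (fun w => \sum_(j < N) a j * (\1_(V j) (Y w) * H w))).
    congr Ex; apply/funext => w; rewrite mulr_suml.
    by apply: eq_bigr => j _; rewrite mulrA.
  rewrite Ex_sum => [|j]; last by apply: bmZ; apply: bmM.
  rewrite Ex_sum => [|j]; last by apply: bmZ.
  rewrite mulr_suml; apply: eq_bigr => j _.
  rewrite ExZ; last by apply: bmM.
  by rewrite HV // ExZ // mulrA.
have -> : Ex (fun w => h (Y w) * H w) - Ex (fun w => h (Y' w)) * c =
    Ex (fun w => (h (Y w) - g (Y w)) * H w) -
    Ex (fun w => h (Y' w) - g (Y' w)) * c.
  rewrite (_ : (fun w => (h (Y w) - g (Y w)) * H w) =
      (fun w => h (Y w) * H w - g (Y w) * H w)); last first.
    by apply/funext => w; rewrite mulrBl.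
  by rewrite !ExB ?gE //; [ring|apply: bmM|apply: bmM].
have -> : e = e / D * `|K| + e / D * `|c| + e / D.
  rewrite -mulrDr -[X in _ + X]mulr1 -mulrDr -/D mulfVK //.
  by rewrite gt_eqF.
have eD : 0 <= e / D by rewrite divr_ge0 // ltW.
apply: le_trans (ler_normB _ _) _; apply: ler_wpDr => //; apply: lerD.
  apply: Ex_norm_le; first by apply: bmM => //; apply: bmB.
  by move=> w; rewrite normrM ler_pM // (le_trans (HK w)) // ler_norm.
rewrite normrM ler_wpM2r //; apply: Ex_norm_le; first exact: bmB.
by move=> w; exact: hV.
Qed.

End RealExpectation.

(** * Factorization of expectations against future sketches *)

Section Independence.
Context d (T : measurableType d) (R : realType) (P : probability T R).
Context d' (E : measurableType d') (X : nat -> {RV P >-> E}).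
Implicit Types (G : T -> R) (J : seq nat) (U : nat -> set E).

Definition tail_event J U (w : T) : R := \prod_(i <- J) \1_(U i) (X i w).

Lemma bm_tail_event J U :
  (forall i, measurable (U i)) -> bounded_measurable (tail_event J U).
Proof.
move=> mU; apply: bm_prod => i; apply: bm_comp; exact: bm_indic.
Qed.

(* [G] is to be thought of as a function of [X 0, ..., X k.-1]. *)
Definition indep_of_tail (k : nat) G : Prop := bounded_measurable G /\
  forall J U, uniq J -> (forall i, i \in J -> (k <= i)%N) ->
    (forall i, measurable (U i)) ->
    Ex P (fun w => G w * tail_event J U w) =
    Ex P G * \prod_(i <- J) Ex P (fun w => \1_(U i) (X i w)).

(** The product rule for events enters here: a product of indicators is the indicator of the
    intersection of the preimages. *)
Lemma indep_of_tail_cst : independent_seq X ->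
  forall c : R, indep_of_tail 0 (fun _ => c).
Proof.
move=> hX c; split; first exact: bm_cst.
move=> J U uJ _ mU; rewrite ExZ ?Ex_cst; last exact: bm_tail_event.
congr (_ * _).
have mXU i : measurable (X i @^-1` U i).
  by rewrite -[X in measurable X]setTI; exact: measurable_funP.
have -> : tail_event J U = \1_(\bigcap_(i in [set` J]) X i @^-1` U i).
  apply/funext => w; rewrite /tail_event indicE.
  have [wU|wU] := boolP (w \in _).
    rewrite big_seq big1 // => i iJ; rewrite indicE mem_set //.
    exact: (set_mem wU).
  have [[i iJ wUi]|H] := pselect (exists2 i, i \in J & ~ U i (X i w)).
    by rewrite (big_rem i) //= indicE memNset // mul0r.
  case/negP: wU; apply/mem_set => i iJ; apply: contrapT => wUi.
  by apply: H; exists i.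
rewrite Ex_indic; last first.
  by apply: fin_bigcap_measurable => //; exact: finite_seq.
rewrite hX //; elim: J {uJ} => [|i J IH]; first by rewrite !big_nil.
rewrite !big_cons fineM ?IH //.
- by congr (_ * _); rewrite -Ex_indic.
- exact: fin_num_measure.
- elim: J {IH} => [|j J IH]; rewrite ?big_nil // big_cons.
  by apply: fin_numM => //; exact: fin_num_measure.
Qed.

Lemma indep_of_tail_sum k (I : Type) (r : seq I) (F : I -> T -> R) :
  (forall i, indep_of_tail k (F i)) ->
  indep_of_tail k (fun w => \sum_(i <- r) F i w).
Proof.
move=> hF; have bF i : bounded_measurable (F i) by case: (hF i).
split; first exact: bm_sum.
move=> J U uJ kJ mU; rewrite Ex_sum // mulr_suml.
have bJ := bm_tail_event J mU.
under [in LHS]eq_fun do rewrite mulr_suml.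
rewrite Ex_sum => [|i]; last exact: bmM.
by apply: eq_bigr => i _; case: (hF i) => _ ->.
Qed.

(** It suffices to treat an indicator [h], and then the condition on [X k] is one more event, with
    index [k], added to those of [J]. *)
Lemma indep_factor k G J U (h : E -> R) : indep_of_tail k G ->
  uniq J -> (forall i, i \in J -> (k < i)%N) -> (forall i, measurable (U i)) ->
  bounded_measurable h ->
  Ex P (fun w => h (X k w) * (G w * tail_event J U w)) =
  Ex P (fun w => h (X k w)) *
  (Ex P G * \prod_(i <- J) Ex P (fun w => \1_(U i) (X i w))).
Proof.
move=> [bG hG] uJ kJ mU; apply: bounded_factor.
  by apply: bmM => //; exact: bm_tail_event.
(* All indices in [J] exceed [k], so changing [U] at [k] leaves their events alone and keeps
   [k :: J] duplicate-free. *)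
move=> V mV; pose U' i := if i == k then V else U i.
have U'k : U' k = V by rewrite /U' eqxx.
have U'E i : i \in J -> U' i = U i.
  by move=> /kJ; rewrite /U'; case: ltngtP.
have := hG (k :: J) U'; rewrite /tail_event.
have -> : (fun w => G w * \prod_(i <- k :: J) \1_(U' i) (X i w)) =
    (fun w => \1_V (X k w) * (G w * \prod_(i <- J) \1_(U i) (X i w))).
  apply/funext => w; rewrite big_cons U'k mulrCA; congr (_ * (_ * _)).
  by apply: eq_big_seq => i /U'E ->.
rewrite big_cons U'k mulrCA => -> //.
- by congr (_ * (_ * _)); apply: eq_big_seq => i /U'E ->.
- by rewrite /= uJ andbT; apply/negP => /kJ; rewrite ltnn.
- by move=> i; rewrite inE => /predU1P[->//|/kJ/ltnW].
- by move=> i; rewrite /U'; case: ifP.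
Qed.

Lemma indep_mean k G (h : E -> R) : indep_of_tail k G -> bounded_measurable h ->
  Ex P (fun w => h (X k w) * G w) = Ex P (fun w => h (X k w)) * Ex P G.
Proof.
move=> hG bh; have := @indep_factor k G [::] (fun=> setT) h hG isT.
rewrite big_nil mulr1 => <- //.
by congr Ex; apply/funext => w; rewrite /tail_event big_nil mulr1.
Qed.

(** A factor depending on [X k] uses up index [k]. The factorization is applied with [J], then with
    no events to reassemble the expectation of the product. *)
Lemma indep_of_tailS k G (h : E -> R) : indep_of_tail k G ->
  bounded_measurable h -> indep_of_tail k.+1 (fun w => h (X k w) * G w).
Proof.
move=> hG bh; split.
  by apply: bmM; [exact: bm_comp|case: hG].
move=> J U uJ kJ mU; under [in LHS]eq_fun do rewrite -mulrA.
by rewrite indep_factor // indep_mean // mulrA.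
Qed.

Lemma same_distribution_Ex (Y Y' : {RV P >-> E}) (h : E -> R) :
  same_distribution Y Y' -> bounded_measurable h ->
  Ex P (fun w => h (Y w)) = Ex P (fun w => h (Y' w)).
Proof.
move=> YY bh; have := @bounded_factor _ _ _ P _ _ Y Y' (fun=> 1) 1.
move=> /(_ (bm_cst _ _)) H; have := H _ h bh.
rewrite mulr1 => <-; first by congr Ex; apply/funext => w; rewrite mulr1.
move=> V mV; rewrite mulr1.
have pre (Z : {RV P >-> E}) : measurable (Z @^-1` V).
  by rewrite -[X in measurable X]setTI; exact: measurable_funP.
transitivity (Ex P \1_(Y @^-1` V)).
  by congr Ex; apply/funext => w; rewrite mulr1.
transitivity (Ex P \1_(Y' @^-1` V)); last by congr Ex.
by rewrite !Ex_indic //; congr fine; exact: YY.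
Qed.

End Independence.

(** * Contraction of the expected squared error *)

Lemma normB_sqr (R : realType) (n : nat) (B : 'M[R]_n) (x : 'cV[R]_n) :
  posdef B -> normB B x ^+ 2 = quad B x.
Proof. by move=> Bpos; rewrite /normB sqr_sqrtr // posdef_ge0. Qed.

Lemma lambda_min_sqrt (R : realType) (n : nat) (B N : 'M[R]_n) :
  (0 < n)%N -> B^T = B -> posdef B -> N^T = N -> posdef N ->
  let l := lambda_min (spd_sqrt (invmx B) *m N *m spd_sqrt (invmx B)) in
  0 < l /\ forall v, l * quad B v <= quad N v.
Proof.
move=> n0 Bsym Bpos Nsym Npos; have Bu := posdef_unit Bpos.
have Wsym : (invmx B)^T = invmx B by rewrite trmx_inv Bsym.
have [] := spd_sqrtP Wsym (posdef_invmx Bsym Bpos).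
set Q := spd_sqrt _ => Qsym Qpos QQ l.
have NQ : Q *m N *m Q = Q^T *m N *m Q by rewrite Qsym.
have [] := @lambda_minP _ _ (Q *m N *m Q) n0.
  by rewrite !trmx_mul Qsym Nsym mulmxA.
rewrite -/l => /eigenvalueP[e eE e0] lmin; split => [|v].
  have ee : 0 < (e *m e^T) 0 0.
    have := trmx_mul_ge0 e^T; have := trmx_mul_eq0 e^T.
    by rewrite trmxK le_eqVlt eq_sym => -> /orP[|//]; rewrite trmx_eq0 (negPf e0).
  have : 0 < quad N (Q *m e^T).
    apply: Npos; apply: contra_neq e0 => Qe.
    by rewrite -[e]trmxK -[e^T](mulKmx (posdef_unit Qpos)) Qe mulmx0 trmx0.
  by rewrite -quad_congr -NQ /quad trmxK eE -scalemxAl mxE pmulr_lgt0.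
(* This is [invmx Q *m v], because [Q *m Q = invmx B]; hence [Q *m u = v] and the squared Euclidean
   norm of [u] is [quad B v]. *)
pose u := Q *m B *m v.
have Qu : Q *m u = v by rewrite /u !mulmxA QQ mulVmx // mul1mx.
have := lmin u; rewrite NQ quad_congr Qu.
suff -> : u^T *m u = v^T *m B *m v by [].
by rewrite [u^T]trmx_mul trmx_mul Qsym Bsym -!mulmxA Qu mulmxA.
Qed.

Section Iterates.
Context (R : realType) (m n : nat).
Context (A : 'M[R]_(m, n)) (b : 'cV[R]_m) (xs : 'cV[R]_n) (B : 'M[R]_n).
Hypotheses (hxs : A *m xs = b) (Bsym : B^T = B) (Bpos : posdef B).

Lemma iterates_error (x0 : 'cV[R]_n) (s : nat -> sketch R m) k :
  iterates A b B x0 s k.+1 - xs =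
  (1%:M - invmx B *m sketchZ A B (s k)) *m (iterates A b B x0 s k - xs).
Proof.
rewrite /= -hxs -mulmxBr mulmxBl mul1mx addrAC; congr (_ - _).
by rewrite /sketchZ !mulmxA.
Qed.

Lemma bm_sketchZ i j : bounded_measurable (fun s => sketchZ A B s i j).
Proof.
split; first exact: measurable_sketchZ.
by exists (B i i + B j j) => s; exact: sketchZ_bound.
Qed.

Lemma bm_error_step i j : bounded_measurable (fun s : sketch R m =>
  (1%:M - invmx B *m sketchZ A B s) i j).
Proof.
rewrite (_ : (fun _ => _) = (fun s : sketch R m => (1%:M : 'M[R]_n) i j -
    \sum_l invmx B i l * sketchZ A B s l j)); last first.
  apply/funext => s; rewrite [LHS]mxE [X in _ + X]mxE.
  by congr (_ - _); rewrite mxE.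
apply: bmB; first exact: bm_cst.
apply: bm_sum => l; apply: bmZ; exact: bm_sketchZ.
Qed.

Context (d : measure_display) (T : measurableType d) (P : probability T R).
Context (S : {RV P >-> sketch R m}) (Sk : nat -> {RV P >-> sketch R m}).
Hypotheses (hcopy : forall k, same_distribution (Sk k) S).
Hypotheses (hindep : independent_seq Sk).
Variable x0 : 'cV[R]_n.

Let r k w := iterates A b B x0 (fun i => Sk i w) k - xs.
Let EZ := expectation_mx P (fun w => sketchZ A B (S w)).

Lemma expectation_mxE i j : EZ i j = Ex P (fun w => sketchZ A B (S w) i j).
Proof. by rewrite mxE unlock. Qed.

Lemma expectation_mx_sym : EZ^T = EZ.
Proof.
apply/matrixP => i j; rewrite mxE !expectation_mxE; congr Ex.
apply/funext => w; rewrite !sketchZE.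
by rewrite -[in LHS](projZ_sym _ Bsym) mxE.
Qed.

(** The new error is linear in the old one, so degree-two monomials go to combinations of degree-two
    monomials whose coefficients are bounded functions of sketch [k] alone. *)
Lemma indep_error k i j : indep_of_tail Sk k (fun w => r k w i 0 * r k w j 0).
Proof.
elim: k i j => [|k IH] i j.
  exact: (indep_of_tail_cst hindep ((x0 - xs) i 0 * (x0 - xs) j 0)).
pose Q s : 'M[R]_n := 1%:M - invmx B *m sketchZ A B s.
have -> : (fun w => r k.+1 w i 0 * r k.+1 w j 0) = (fun w => \sum_a \sum_c
    (Q (Sk k w) i a * Q (Sk k w) j c) * (r k w a 0 * r k w c 0)).
  apply/funext => w; rewrite /r iterates_error -/(r k w) -/(Q _) !mxE mulr_suml.
  apply: eq_bigr => a _; rewrite mulr_sumr; apply: eq_bigr => c _; ring.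
apply: indep_of_tail_sum => a; apply: indep_of_tail_sum => c.
apply: (@indep_of_tailS _ _ _ _ _ _ _ _ _ (fun s => Q s i a * Q s j c)) => //.
by apply: bmM; exact: bm_error_step.
Qed.

Lemma bm_error k i j : bounded_measurable (fun w => r k w i 0 * r k w j 0).
Proof. by have [] := indep_error k i j. Qed.

Lemma bm_quad (M : T -> 'M[R]_n) k :
  (forall i j, bounded_measurable (fun w => M w i j)) ->
  bounded_measurable (fun w => quad (M w) (r k w)).
Proof.
move=> bM; under eq_fun do rewrite quadE.
by apply: bm_sum => i; apply: bm_sum => j; apply: bmM => //; exact: bm_error.
Qed.

Lemma bm_quad_cst (M : 'M[R]_n) k :
  bounded_measurable (fun w => quad M (r k w)).
Proof. by apply: bm_quad => i j; exact: bm_cst. Qed.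

Lemma Ex_quad_sketchZ k :
  Ex P (fun w => quad (sketchZ A B (Sk k w)) (r k w)) =
  Ex P (fun w => quad EZ (r k w)).
Proof.
have bZ (Y : {RV P >-> sketch R m}) i j :
    bounded_measurable (fun w => sketchZ A B (Y w) i j).
  by apply: (bm_comp (h := fun s => sketchZ A B s i j)); exact: bm_sketchZ.
under [in LHS]eq_fun do rewrite quadE.
under [in RHS]eq_fun do rewrite quadE.
have bE i j := bm_error k i j.
rewrite !Ex_sum => [|i|i]; do ?[by apply: bm_sum => j; apply: bmM => //;
  try exact: bm_cst].
apply: eq_bigr => i _; rewrite !Ex_sum => [|j|j]; do ?[by apply: bmM => //;
  try exact: bm_cst].
apply: eq_bigr => j _; rewrite ExZ // expectation_mxE.
rewrite (@indep_mean _ _ _ _ _ _ _ _ _ (fun s => sketchZ A B s i j)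
  (indep_error k i j) (bm_sketchZ i j)).
by rewrite (same_distribution_Ex (hcopy k) (bm_sketchZ i j)).
Qed.

Lemma energy_step k : Ex P (fun w => quad B (r k.+1 w)) =
  Ex P (fun w => quad B (r k w)) - Ex P (fun w => quad EZ (r k w)).
Proof.
rewrite -Ex_quad_sketchZ -ExB.
- congr Ex; apply/funext => w; rewrite /r iterates_error -/(r k w).
  by rewrite mulmxBl mul1mx sketchZE quad_step.
- exact: bm_quad_cst.
- apply: bm_quad => i j.
  by apply: (bm_comp (h := fun s => sketchZ A B s i j)); exact: bm_sketchZ.
Qed.

(** Averaging the pointwise bound of Z by [B]; this is what makes the rate [rho] nonnegative. *)
Lemma quad_expectation_le v : quad EZ v <= quad B v.
Proof.
have bZ i j : bounded_measurable (fun w => sketchZ A B (S w) i j).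
  by apply: (bm_comp (h := fun s => sketchZ A B s i j)); exact: bm_sketchZ.
have bZv : bounded_measurable (fun w => quad (sketchZ A B (S w)) v).
  under eq_fun do rewrite quadE.
  by apply: bm_sum => i; apply: bm_sum => j; apply: bmM => //; exact: bm_cst.
have -> : quad EZ v = Ex P (fun w => quad (sketchZ A B (S w)) v).
  under [in RHS]eq_fun do rewrite quadE.
  rewrite quadE Ex_sum => [|i]; last first.
    by apply: bm_sum => j; apply: bmM => //; exact: bm_cst.
  apply: eq_bigr => i _; rewrite Ex_sum => [|j]; last first.
    by apply: bmM => //; exact: bm_cst.
  apply: eq_bigr => j _; rewrite expectation_mxE.
  under [in RHS]eq_fun do rewrite mulrC.
  by rewrite ExZ // mulrC.
rewrite -[X in _ <= X](Ex_cst P); apply: Ex_le => // [|w]; first exact: bm_cst.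
by rewrite sketchZE projZ_le.
Qed.

Lemma error_contraction (rho : R) k : 0 <= rho ->
  (forall v, (1 - rho) * quad B v <= quad EZ v) ->
  Ex P (fun w => quad B (r k w)) <= rho ^+ k * quad B (x0 - xs).
Proof.
move=> rho0 hrho; elim: k => [|k IH]; first by rewrite expr0 mul1r -[X in _ <= X](Ex_cst P).
(* Multiplying the induction hypothesis by [rho] requires [0 <= rho]. *)
rewrite energy_step exprS -mulrA; apply: le_trans (ler_wpM2l rho0 IH).
have : Ex P (fun w => (1 - rho) * quad B (r k w)) <= Ex P (fun w => quad EZ (r k w)).
  by apply: Ex_le => //; [apply: bmZ|]; exact: bm_quad_cst.
by rewrite ExZ; [lra|exact: bm_quad_cst].
Qed.

End Iterates.

Theorem theorem16 (R : realType) (m n : nat) (hn : (0 < n)%N)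
    (A : 'M[R]_(m, n)) (b : 'cV[R]_m) (xs : 'cV[R]_n) (hxs : A *m xs = b)
    (B : 'M[R]_n) (hBsym : B^T = B) (hBpos : posdef B)
    (d : measure_display) (T : measurableType d) (P : probability T R)
    (S : {RV P >-> sketch R m})
    (Sk : nat -> {RV P >-> sketch R m})
    (hcopy : forall k : nat, same_distribution (Sk k) S)
    (hindep : independent_seq Sk)
    (x0 : 'cV[R]_n)
    (hEZ : posdef (expectation_mx P (fun w => sketchZ A B (S w)))) :
  let EZ := expectation_mx P (fun w => sketchZ A B (S w)) in
  let Bmh := spd_sqrt (invmx B) in
  let rho := 1 - lambda_min (Bmh *m EZ *m Bmh) in
  let x (k : nat) (w : T) := iterates A b B x0 (fun i => Sk i w) k in
  rho < 1 /\
  forall k : nat,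
    ('E_P[(fun w : T => normB B (x k w - xs) ^+ 2)%R] <=
     (rho ^+ k * normB B (x0 - xs) ^+ 2)%:E)%E.
Proof.
move=> EZ Bmh rho x.
have EZsym : EZ^T = EZ by exact: expectation_mx_sym.
have [] := lambda_min_sqrt hn hBsym hBpos EZsym hEZ.
rewrite -/Bmh; set l := lambda_min _ => l0 lEZ.
have rhoE : 1 - rho = l by rewrite /rho subKr.
split; first by rewrite /rho ltrBlDr ltrDl.
have rho0 : 0 <= rho.
  (* Any nonzero vector, available since [0 < n], yields [l <= 1] from
     [l * quad B v <= quad EZ v <= quad B v]. *)
  pose v : 'cV[R]_n := const_mx 1.
  have v0 : 0 < quad B v.
    apply: hBpos; apply/eqP => /matrixP/(_ (Ordinal hn) 0)/eqP.
    by rewrite !mxE oner_eq0.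
  have := le_trans (lEZ v) (quad_expectation_le A hBsym hBpos S v).
  by rewrite ger_pMl // /rho subr_ge0.
move=> k; rewrite unlock normB_sqr //.
under eq_integral do rewrite /= normB_sqr //.
rewrite ExE; last by apply: bm_quad_cst.
rewrite lee_fin; apply: (error_contraction hxs hBsym hBpos hcopy hindep) => //.
by rewrite rhoE.
Qed.
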